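(* Let $G=(V,E)$ be a graph on $n$ vertices with average degree $\bar{d}$, let $K$ be a constant positive integer, and let $G'=(V,E')$ be the port-labelled multigraph described in the context. For a vertex $v$ chosen uniformly at random from $V$ and a permutation $\pi$ chosen uniformly at random over $E'$, $$\mathbb{E}_{v,\pi}[T(v,\pi)]=O(\bar{d}\cdot\log^2 n).$$
   Context: Each vertex $w$ has two ports $w^0,w^1$. The multigraph $G'$ has, for each edge $(u,v)\in E$, $K+2$ parallel copies: one copy that occupies ports $u^0$ and $v^1$, one that occupies $u^1$ and $v^0$, and $K$ copies that each occupy $u^0$ and $v^0$. Two edges $e,e'\in E'$ sharing an endpoint $w$ form a conflicting pair if both occupy the same port $w^i$ ($i\in\{0,1\}$). Given a permutation (ranking) $\pi$ of $E'$, define two recursive procedures. The edge oracle $\mathrm{EO}(e,u,\pi)$ (where $u$ is an endpoint of $e$): if $\mathrm{EO}(e,u,\pi)$ has been computed before, return the stored result; otherwise, let $e_1,\dots,e_r$ be the edges of $E'$ that form a conflicting pair with $e$ and satisfy $\pi(e_1)<\dots<\pi(e_r)<\pi(e)$, with $v_i$ the endpoint of $e_i$ not shared with $e$; for $i=1,\dots,r$, if $\mathrm{EO}(e_i,v_i,\pi)$ returns true then return false; finally return true. The vertex oracle $\mathrm{VO}(u,\pi)$: let $e_1=(u,v_1),\dots,e_r=(u,v_r)$ be the edges of $E'$ incident to $u$ with $\pi(e_1)<\dots<\pi(e_r)$; set $d\gets 0$; for $i=1,\dots,r$, if $\mathrm{EO}(e_i,v_i,\pi)$ returns true then $d\gets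 d+1$; return $d$. $T(v,\pi)$ denotes the number of (recursive) calls to the edge oracle during the execution of $\mathrm{VO}(v,\pi)$. *)

(* Defs.v *)
From Stdlib Require Import Reals.
From mathcomp Require Import all_boot perm.

Set Implicit Arguments.
Unset Strict Implicit.
Unset Printing Implicit Defensive.

Section PortGraph.

Variables (n : nat) (adj : rel 'I_n) (K : nat).

Definition num_edges : nat :=
  #|[set p : 'I_n * 'I_n | (p.1 < p.2)%N && adj p.1 p.2]|.

(* E' : for every edge {u,v} of G (stored with u < v), K+2 parallel copies
   indexed by j : 'I_(K+2).  Copy j = 0 occupies ports u^0 and v^1,
   copy j = 1 occupies u^1 and v^0, copies j >= 2 occupy u^0 and v^0. *)
Definition Eprime : finType :=
  {x : 'I_n * 'I_n * 'I_(K.+2) | (x.1.1 < x.1.2)%N && adj x.1.1 x.1.2}.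

Definition ep1 (e : Eprime) : 'I_n := (val e).1.1.
Definition ep2 (e : Eprime) : 'I_n := (val e).1.2.
(* ports as booleans: false = port 0, true = port 1 *)
Definition port1 (e : Eprime) : bool := (nat_of_ord (val e).2 == 1%N).
Definition port2 (e : Eprime) : bool := (nat_of_ord (val e).2 == 0%N).

Definition is_endpoint (e : Eprime) (w : 'I_n) : bool := (w == ep1 e) || (w == ep2 e).
Definition port_at (e : Eprime) (w : 'I_n) : bool :=
  if w == ep1 e then port1 e else port2 e.
Definition other (f : Eprime) (w : 'I_n) : 'I_n :=
  if w == ep1 f then ep2 f else ep1 f.

Definition conflict_at (e f : Eprime) (w : 'I_n) : bool :=
  [&& e != f, is_endpoint e w, is_endpoint f w & port_at e w == port_at f w].

Definition conflicting (e f : Eprime) : bool :=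
  conflict_at e f (ep1 e) || conflict_at e f (ep2 e).

Definition conflict_vertex (e f : Eprime) : 'I_n :=
  if conflict_at e f (ep1 e) then ep1 e else ep2 e.

Variable sigma : {perm Eprime}.

Definition rank (e : Eprime) : nat := enum_rank (sigma e).

Definition sort_by_rank (s : seq Eprime) : seq Eprime :=
  sort (fun a b => (rank a <= rank b)%N) s.

Definition lower_conflicts (e : Eprime) : seq Eprime :=
  sort_by_rank [seq f <- enum Eprime | conflicting e f && (rank f < rank e)%N].

(* state: memo table of computed EO(e,u) results, and number of EO calls *)
Definition state : Type := (seq ((Eprime * 'I_n) * bool) * nat)%type.

Definition memo_lookup (m : seq ((Eprime * 'I_n) * bool)) (k : Eprime * 'I_n)
  : option bool :=
  match [seq p.2 | p <- m & p.1 == k] with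
  | b :: _ => Some b
  | [::] => None
  end.

(* The edge oracle EO(e,u,pi), with memoization; every invocation
   (including those answered from the memo table) increments the counter.
   [fuel] only ensures termination: with fuel > rank e it is never exhausted. *)
Fixpoint EO (fuel : nat) (e : Eprime) (u : 'I_n) (st : state) : bool * state :=
  let st1 := (st.1, st.2.+1) in
  match memo_lookup st1.1 (e, u) with
  | Some b => (b, st1)
  | None =>
    match fuel with
    | 0 => (true, st1)
    | f.+1 =>
      let fix loop (l : seq Eprime) (s : state) : bool * state :=
        match l with
        | [::] => (true, s)
        | g :: l' =>
          let r := EO f g (other g (conflict_vertex e g)) s in
          if r.1 then (false, r.2) else loop l' r.2
        end in
      let r := loop (lower_conflicts e) st1 in
      (r.1, (((e, u), r.1) :: r.2.1, r.2.2))
    end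
  end.

Definition incident (v : 'I_n) : seq Eprime :=
  sort_by_rank [seq e <- enum Eprime | is_endpoint e v].

Definition VO_run (v : 'I_n) : nat * state :=
  foldl (fun (acc : nat * state) e =>
           let r := EO #|Eprime|.+1 e (other e v) acc.2 in
           ((if r.1 then acc.1.+1 else acc.1), r.2))
        (0%N, ([::], 0%N)) (incident v).

Definition T (v : 'I_n) : nat := (VO_run v).2.2.

End PortGraph.

Definition expected_T (n : nat) (adj : rel 'I_n) (K : nat) : R :=
  Rdiv (INR (\sum_(v : 'I_n) \sum_(s : {perm Eprime adj K}) T s v))
       (Rmult (INR n) (INR #|{perm Eprime adj K}|)).

Definition avg_degree (n : nat) (adj : rel 'I_n) : R :=
  Rdiv (Rmult 2 (INR (num_edges adj))) (INR n).

(* Main.v *)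
Require Import Defs.
From Stdlib Require Import Reals Lia Lra.
From mathcomp Require Import all_boot perm.
From mathcomp Require Import zify.

Set Implicit Arguments.
Unset Strict Implicit.
Unset Printing Implicit Defensive.

(** Splitting every vertex into its two ports turns the procedure into greedy
    matching: an edge is accepted iff no clashing edge of lower rank is.  Charging
    each call to the memo entry of its caller bounds T(v,pi) by deg(v) plus twice
    the number of pairs (e,g) such that e is reachable from v and calls g.

    Each such pair lies on a query path g = q_0, q_1 = e, ..., q_k whose edges
    beyond g never meet three in a row at one port (otherwise shortcut it).
    Rotating the ranks along the path, so that q_(i+1) receives the rank of q_i and
    q_0 that of q_k, loses almost no information: the new permutation, g, the
    length k and two bits determine the path and the old permutation.  So for each
    length there are at most 4 |E'| |E'|! pairs of a permutation and a path.

    It remains to see that paths longer than O(log^2 n) are rare.  An edge that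
    calls g is still alive when g is revealed.  At time t no port has more than
    about (log n) |E'| / t alive edges, since revealing any of them kills all of
    them; and under these degree bounds the number of paths, counted with weight
    2^length, grows in expectation only to |E'|^O(log n). *)

(** * Greedy acceptance and query paths *)

Section Ports.

Variables (E X : finType) (p1 p2 : E -> X).

Definition has_port (x : X) (e : E) := (x == p1 e) || (x == p2 e).
Definition clash (e f : E) :=
  (e != f) && (has_port (p1 e) f || has_port (p2 e) f).

Lemma clashP (e f : E) :
  reflect (e <> f /\ exists2 x, has_port x e & has_port x f) (clash e f).
Proof.
apply: (iffP andP) => [[/eqP nef]|[nef [x]]].
  case/orP=> h; split=> //; [exists (p1 e) | exists (p2 e)] => //.
    by rewrite /has_port eqxx.
  by rewrite /has_port eqxx orbT.
by case/orP=> /eqP -> h; split; try exact/eqP; rewrite h ?orbT.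
Qed.

Lemma clash_port (x : X) (e f : E) :
  e <> f -> has_port x e -> has_port x f -> clash e f.
Proof. by move=> nef xe xf; apply/clashP; split=> //; exists x. Qed.

Lemma clash_sym : symmetric clash.
Proof.
by move=> e f; apply/clashP/clashP => -[nef [x xe xf]]; split;
  [move/esym | exists x | move/esym | exists x].
Qed.

Implicit Types (r : E -> nat) (e f g h : E) (x : X).

Fixpoint greedy_rec r k e : bool :=
  if k is k'.+1 then
    [forall f, clash e f && (r f < r e) ==> ~~ greedy_rec r k' f]
  else true.

Definition greedy r e := greedy_rec r (r e).+1 e.

Lemma greedy_rec_fuel r k e : r e < k -> greedy_rec r k e = greedy r e.
Proof.
rewrite /greedy.
have gen n : forall e k k', r e < n -> r e < k -> r e < k' ->
    greedy_rec r k e = greedy_rec r k' e.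
  elim: n => // n IHn {}e [|k1] [|k2] // en ek1 ek2 /=.
  apply: eq_forallb => f; case: (boolP (_ && _)) => //= /andP[_ fe].
  by congr (~~ _); apply: IHn; apply: leq_trans fe _.
by move=> ek; apply: (gen (r e).+1).
Qed.

Lemma greedyE r e :
  greedy r e = [forall f, clash e f && (r f < r e) ==> ~~ greedy r f].
Proof.
rewrite {1}/greedy /=; apply: eq_forallb => f.
by case: (boolP (_ && _)) => //= /andP[_ fe]; rewrite greedy_rec_fuel.
Qed.

(** The disjunction makes both rankings reveal the same edges at the same times before [t]; edges
    that both place at [t] or later are unconstrained. *)
Definition agree_below t r r' := forall e, (r e < t) || (r' e < t) -> r e = r' e.

Lemma agree_below_lt t r r' s e :
  agree_below t r r' -> s <= t -> (r e < s) = (r' e < s).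
Proof.
move=> ag st; case: (boolP ((r e < t) || (r' e < t))) => [/ag-> //|].
by rewrite negb_or -!leqNgt => /andP[h1 h2]; rewrite !ltnNge !(leq_trans st).
Qed.

Lemma greedy_agree t r r' e :
  agree_below t r r' -> r e < t -> greedy r e = greedy r' e.
Proof.
move=> ag; move: {2}(r e).+1 (ltnSn (r e)) => n.
elim: n e => // n IHn e en et; rewrite !greedyE.
have re : r e = r' e by apply: ag; rewrite et.
apply: eq_forallb => f; rewrite -re.
rewrite -(agree_below_lt f ag (ltnW et)).
case: (boolP (_ && _)) => //= /andP[_ fe]; congr (~~ _).
by apply: IHn; [apply: leq_trans fe _ | apply: ltn_trans fe et].
Qed.

(* [EO] at [e] gets as far as [g] in its loop. *)
Definition calls r e g :=
  [&& clash e g, r g < r e &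
      [forall h, clash e h && (r h < r g) ==> ~~ greedy r h]].

Lemma calls_clash r e g : calls r e g -> clash e g.
Proof. by case/and3P. Qed.

Lemma calls_lt r e g : calls r e g -> r g < r e.
Proof. by case/and3P. Qed.

Lemma calls_rejected r e g h :
  calls r e g -> clash e h -> r h < r g -> ~~ greedy r h.
Proof. by case/and3P=> _ _ /forallP/(_ h)/implyP H eh hg; apply: H; rewrite eh. Qed.

(** Whatever precedes [a] also precedes [b], so [c] has already found all of its clashing edges
    there rejected; the common port makes [c] clash with [a]. *)
Lemma calls_shortcut r x a b c :
  calls r c b -> calls r b a ->
  has_port x a -> has_port x c -> calls r c a.
Proof.
move=> cb ba xa xc; have lt := ltn_trans (calls_lt ba) (calls_lt cb).
apply/and3P; split=> //.
  by apply: (@clash_port x) => // ca; rewrite ca ltnn in lt.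
apply/forallP=> h; apply/implyP=> /andP[ch ha].
exact: (calls_rejected cb ch (ltn_trans ha (calls_lt ba))).
Qed.

Definition called_by r : rel E := fun g e => calls r e g.

(* A query path, read from the last edge called back to the first one. *)
Definition query_path r (q : seq E) := sorted (called_by r) q.

Lemma query_path_sorted r q :
  query_path r q -> sorted (fun a b => r a < r b) q.
Proof. by apply: sub_sorted => a b /calls_lt. Qed.

Lemma query_path_uniq r q : query_path r q -> uniq q.
Proof.
move/query_path_sorted; apply: sorted_uniq => [b a c|a]; last exact: ltnn.
exact: ltn_trans.
Qed.

Lemma query_path_lt r q e0 i j : query_path r q -> j < size q -> i < j ->
  r (nth e0 q i) < r (nth e0 q j).
Proof.
move=> /query_path_sorted sq js ij.
apply: (sorted_ltn_nth (leT := fun a b => r a < r b) _ e0 sq) => //.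
  by move=> b a c; apply: ltn_trans.
by rewrite inE (ltn_trans ij).
Qed.

Lemma query_path_calls r q e0 i : query_path r q -> i.+1 < size q ->
  calls r (nth e0 q i.+1) (nth e0 q i).
Proof. by move=> /(sortedP e0)/(_ i). Qed.

Fixpoint triple_free (q : seq E) : bool :=
  if q is a :: q1 then
    (if q1 is b :: c :: _ then
       ~~ [exists x, [&& has_port x a, has_port x b & has_port x c]]
     else true) && triple_free q1
  else true.

Lemma triple_free_nth q e0 i x : triple_free q -> i.+2 < size q ->
  has_port x (nth e0 q i) -> has_port x (nth e0 q i.+1) ->
  has_port x (nth e0 q i.+2) -> False.
Proof.
elim: q i => // a q IHq [|i] /= /andP[H tf] sz.
  case: q H {IHq tf} sz => [|b [|c q]] //= /existsPn/(_ x) H _ xa xb xc.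
  by rewrite xa xb xc in H.
exact: IHq.
Qed.

Lemma triple_freePn q : ~~ triple_free q ->
  exists q1 a b c q2 x, [/\ q = q1 ++ [:: a, b, c & q2], has_port x a,
    has_port x b & has_port x c].
Proof.
elim: q => // a q IHq; rewrite [triple_free _]/= negb_and => /orP[|/IHq].
  case: q {IHq} => [|b [|c q]] //; rewrite negbK => /existsP[x /and3P[xa xb xc]].
  by exists [::], a, b, c, q, x.
case=> q1 [b [c [d [q2 [x [-> xb xc xd]]]]]].
by exists (a :: q1), b, c, d, q2, x.
Qed.

(** [calls_shortcut] cuts the middle edge out of any bad triple from [e] on. Triples starting at [g]
    are left alone: a cut there would delete [e] and lose the pair to be counted. *)
Lemma query_path_reduce r g q e : query_path r (g :: e :: q) ->
  exists q', [/\ query_path r (g :: e :: q'), triple_free (e :: q'),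
                 last e q' = last e q & size q' <= size q].
Proof.
have [n] := ubnP (size q); elim: n q => // n IHn q qn qP.
case: (boolP (triple_free (e :: q))) => [tf|]; first by exists q.
case/triple_freePn=> q1 [a [b [c [q2 [x [eq xa xb xc]]]]]].
pose q' := behead (q1 ++ [:: a, c & q2]).
have eq' : e :: q' = q1 ++ [:: a, c & q2].
  by rewrite /q'; case: (q1) eq => [[->]|? ? [->]].
have szq : size q = (size q').+1.
  by have := congr1 size eq; have := congr1 size eq'; rewrite /= !size_cat /=; lia.
have [||q0 [p0 t0 l0 s0]] := IHn q'; first by lia.
  rewrite /query_path eq'; move: qP; rewrite /query_path eq.
  rewrite /= !cat_path /= => /and5P[-> -> ab bc ->]; rewrite andbT /=.
  exact: (calls_shortcut bc ab xa xc).
exists q0; split=> //; last by lia.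
rewrite l0 -[last e q']/(last e (e :: q')) -[last e q]/(last e (e :: q)).
by rewrite eq eq' !last_cat.
Qed.

End Ports.

(** * Decoding a path from the rotated ranks *)

Section Decoding.

Variables (E X : finType) (p1 p2 : E -> X).

Local Notation has_port := (has_port p1 p2).
Local Notation clash := (clash p1 p2).
Local Notation calls := (calls p1 p2).
Local Notation query_path := (query_path p1 p2).

Implicit Types (r rho : E -> nat) (q : seq E).

(* Along the path [q] each rank moves one step towards the first edge called,
   and the top rank goes to the head of [q]; nothing else changes. *)
Definition rotated r rho q :=
  (forall e0 i, i.+1 < size q -> rho (nth e0 q i.+1) = r (nth e0 q i)) /\
  (forall e, e \notin q -> rho e = r e).

Lemma mem_nth_ex (e0 e : E) q :
  e \in q -> exists2 j, j < size q & nth e0 q j = e.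
Proof. by move/(nthP e0). Qed.

Section Comparison.

Variables (r r' rho : E -> nat) (q q' : seq E) (e0 : E) (i : nat).
Hypotheses (qP : query_path r q) (qP' : query_path r' q').
Hypotheses (qR : rotated r rho q) (qR' : rotated r' rho q').
Hypotheses (eq_size : size q = size q') (lt_i : i.+1 < size q).
Hypothesis eq_nth_le : forall j, j <= i -> nth e0 q j = nth e0 q' j.
Hypothesis le_ri : r (nth e0 q i) <= r' (nth e0 q' i).

Let nth_le j : i <= j -> j < size q -> r (nth e0 q i) <= r (nth e0 q j).
Proof.
rewrite leq_eqVlt => /orP[/eqP->//|ij] jq.
by apply/ltnW/(query_path_lt e0 qP).
Qed.

Let nth_le' j : i <= j -> j < size q' -> r' (nth e0 q' i) <= r' (nth e0 q' j).
Proof.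
rewrite leq_eqVlt => /orP[/eqP->//|ij] jq.
by apply/ltnW/(query_path_lt e0 qP').
Qed.

(** Off both paths, both ranks equal [rho]. On the common prefix before [i], both are read off [rho]
    at the next edge. All remaining edges have rank at least [r (nth e0 q i)] in both rankings. *)
Lemma rotated_agree : agree_below (r (nth e0 q i)) r r'.
Proof.
move=> e; have uq := query_path_uniq qP; have uq' := query_path_uniq qP'.
case: (boolP (e \in q)) => [/(mem_nth_ex e0)[j jq <-{e}]|eq].
  have [ji|ij|->] := ltngtP j i; first 1 last.
  - have rij := query_path_lt e0 qP jq ij.
    rewrite ltnNge (ltnW rij) /=.
    case: (boolP (nth e0 q j \in q')) => [/(mem_nth_ex e0)[k kq ek]|eq'].
      have [ki|ik] := leqP k i.
        have : nth e0 q k == nth e0 q j by rewrite eq_nth_le // ek.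
        by rewrite nth_uniq ?eq_size // -?eq_size //; move/eqP=> kj; lia.
      by have := query_path_lt e0 qP' kq ik; rewrite ek; move: le_ri; lia.
    have := qR'.2 _ eq'; case: j jq ij {rij eq'} => // j jq ij <-.
    by rewrite (qR.1 e0) // ltnNge nth_le // ltnW.
  - by move: le_ri; rewrite ltnn -eq_nth_le //=; lia.
  by move=> _; rewrite -(qR.1 e0) ?(eq_nth_le ji) ?(qR'.1 e0) ?eq_nth_le //; lia.
rewrite -(qR.2 _ eq).
case: (boolP (e \in q')) => [/(mem_nth_ex e0)[j jq ej]|eq']; last first.
  by rewrite -(qR'.2 _ eq').
have [ji|ij] := leqP j i.
  by case/negP: eq; rewrite -ej -eq_nth_le // mem_nth // eq_size.
have := query_path_lt e0 qP' jq ij; rewrite -ej.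
case: j jq ij ej => // j jq ij ej; rewrite (qR'.1 e0) // => lt1.
by have := nth_le' ij (ltnW jq); move: le_ri; lia.
Qed.

(** Otherwise the next edge [c] of [q] clashes with [c'] and precedes the edge that [c'] calls under
    [r'], so it is rejected there by some accepted [h]. The rankings agree that early, so [h] is
    accepted under [r] too, although [c] gets past it. *)
Lemma rotated_eq_next x : injective rho -> has_port x (nth e0 q i.+1) ->
  has_port x (nth e0 q' i.+1) -> nth e0 q i.+1 = nth e0 q' i.+1.
Proof.
move=> rinj xq xq'; apply/eqP/negPn/negP => /eqP neq.
have lt_i' : i.+1 < size q' by rewrite -eq_size.
set c := nth e0 q i.+1 in neq xq *; set c' := nth e0 q' i.+1 in neq xq'.
have rc : rho c = r (nth e0 q i) by apply: qR.1.
have rc' : rho c' = r' (nth e0 q' i) by apply: qR'.1.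
have uq := query_path_uniq qP.
(* An occurrence up to [i] would repeat an edge of [q]; one beyond [i.+1] would give [c] too large a
   rank under [rho]. *)
have c_q' : c \notin q'.
  apply/negP => /(mem_nth_ex e0)[j jq ej].
  have [ji|ij] := leqP j i.
    have : nth e0 q j == nth e0 q i.+1 by rewrite eq_nth_le // ej.
    by rewrite nth_uniq ?eq_size // -?eq_size //; move/eqP=> kj; lia.
  case: j jq ij ej => // j jq ij ej.
  have ij' : i < j.
    rewrite ltn_neqAle -ltnS ij andbT; apply/eqP=> ij'.
    by apply: neq; rewrite -ej -ij'.
  have := query_path_lt e0 qP' (ltnW jq) ij'.
  by rewrite -(qR'.1 e0 j) // ej rc; move: le_ri; lia.
have r'c : r' c = r (nth e0 q i) by rewrite -(qR'.2 _ c_q').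
have lt_r : r' c < r' (nth e0 q' i).
  rewrite ltn_neqAle r'c le_ri andbT -rc -rc'; apply/eqP => /rinj; exact: neq.
have clc := clash_port (fun e => neq (esym e)) xq' xq.
have := calls_rejected (query_path_calls e0 qP' lt_i') clc lt_r.
rewrite greedyE => /forallPn[h]; rewrite negb_imply negbK => /andP[/andP[ch hc]].
rewrite r'c in hc.
have hr : r h < r (nth e0 q i) by rewrite (agree_below_lt _ rotated_agree).
rewrite -(greedy_agree _ _ rotated_agree hr) => gh.
by have := calls_rejected (query_path_calls e0 qP lt_i) ch hr; rewrite gh.
Qed.

End Comparison.

Definition valid r q := query_path r q && triple_free p1 p2 (behead q).

(* The ports through which the path enters its first two edges; past them,
   triple-freeness forces the path to leave an edge by its other port. *)
Definition port_code e0 q :=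
  (has_port (p1 (nth e0 q 0)) (nth e0 q 1),
   has_port (p1 (nth e0 q 1)) (nth e0 q 2)).

Lemma common_port r q e0 i : query_path r q -> i.+1 < size q ->
  exists2 x, has_port x (nth e0 q i) & has_port x (nth e0 q i.+1).
Proof.
move=> qP iq; have /calls_clash/clashP[_ [x x1 x2]] := query_path_calls e0 qP iq.
by exists x.
Qed.

Lemma common_port_code r q e0 i (b := has_port (p1 (nth e0 q i)) (nth e0 q i.+1)) :
  query_path r q -> i.+1 < size q ->
  has_port (if b then p1 (nth e0 q i) else p2 (nth e0 q i)) (nth e0 q i.+1).
Proof.
move=> qP iq; rewrite /b; case: ifPn => // np1.
have [x /orP[/eqP-> xb|/eqP->//]] := common_port e0 qP iq.
by rewrite xb in np1.
Qed.

(** Induction along the paths: once the next edges are known to share a port, [rotated_eq_next]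
    identifies them. The first two ports come from the code, the later ones from triple-freeness. *)
Lemma rotated_inj r r' rho q q' e0 : injective rho ->
  valid r q -> valid r' q' -> rotated r rho q -> rotated r' rho q' ->
  size q = size q' -> head e0 q = head e0 q' ->
  port_code e0 q = port_code e0 q' -> q = q'.
Proof.
move=> rinj /andP[qP tf] /andP[qP' tf'] qR qR' eqs eqh [eqb0 eqb1].
suff H i : i < size q -> forall j, j <= i -> nth e0 q j = nth e0 q' j.
  by apply: (@eq_from_nth _ e0) => // i iq; apply: (H i iq).
elim: i => [_ [|//] _|i IHi iq j]; first by rewrite !nth0.
have {}IHi := IHi (ltnW iq).
rewrite leq_eqVlt ltnS => /orP[/eqP->{j}|]; last exact: IHi.
have iq' : i.+1 < size q' by rewrite -eqs.
suff [x xq xq'] : exists2 x, has_port x (nth e0 q i.+1) & has_port x (nth e0 q' i.+1).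
  (* The comparison is asymmetric, so the path with the smaller current rank takes the role of
     [q]. *)
  have [le|/ltnW le] := leqP (r (nth e0 q i)) (r' (nth e0 q' i)).
    exact: rotated_eq_next qP qP' qR qR' eqs iq IHi le x rinj xq xq'.
  apply/esym.
  apply: rotated_eq_next qP' qP qR' qR (esym eqs) iq' _ le x rinj xq' xq.
  by move=> j ji; rewrite IHi.
have c1 := common_port_code e0 qP iq; have c2 := common_port_code e0 qP' iq'.
case: i iq iq' IHi c1 c2 => [|[|i]] iq iq' IHi c1 c2.
- by rewrite -eqb0 -IHi // in c2; eexists; [exact: c1|exact: c2].
- by rewrite -eqb1 -IHi // in c2; eexists; [exact: c1|exact: c2].
move=> {c1 c2}.
have [x xa xb] := common_port e0 qP (ltnW iq).
have [y yb yc] := common_port e0 qP iq.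
have [z zb zc] := common_port e0 qP' iq'.
rewrite -IHi // in zb.
have nyz w : has_port w (nth e0 q i.+2) -> has_port w (nth e0 q i.+3) \/
    has_port w (nth e0 q' i.+3) -> w <> x.
  move=> wb wc wx; rewrite {w}wx in wb wc.
  case: wc => wc.
    have := @triple_free_nth _ _ p1 p2 (behead q) e0 i x tf.
    by rewrite size_behead !nth_behead; apply=> //; case: (size q) iq.
  have := @triple_free_nth _ _ p1 p2 (behead q') e0 i x tf'.
  rewrite size_behead !nth_behead -(IHi i.+1) // -(IHi i.+2) //.
  by apply=> //; case: (size q') iq'.
have nyx := nyz y yb (or_introl yc); have nzx := nyz z zb (or_intror zc).
(* The edge has only two ports, and neither continuation may use the entry port [x]. *)
suff yz : y = z by exists y => //; rewrite yz.
move: xb yb zb nyx nzx.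
by case/orP=> /eqP-> /orP[]/eqP-> /orP[]/eqP->.
Qed.

(** Composed before a ranking, the cyclic shift [prev q] gives each edge the rank of its
    predecessor. The identity is a dummy value for sequences with repetitions. *)
Definition rot_perm q : {perm E} :=
  if uniq q =P true is ReflectT uq then perm (can_inj (next_prev uq)) else 1%g.

Lemma rot_permE q e : uniq q -> rot_perm q e = prev q e.
Proof. by rewrite /rot_perm; case: eqP => // uq _; rewrite permE. Qed.

Definition rk (s : {perm E}) e : nat := enum_rank (s e).

Lemma rk_inj s : injective (rk s).
Proof. by move=> e f /val_inj/enum_rank_inj/perm_inj. Qed.

Lemma ltn_rk s e : rk s e < #|E|.
Proof. exact: ltn_ord. Qed.

Lemma rotated_rot_perm s q : uniq q -> rotated (rk s) (rk (rot_perm q * s)%g) q.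
Proof.
move=> uq; split=> [e0 i iq|e eq]; rewrite /rk permM rot_permE // prev_nth.
  case: q uq iq => // a q /andP[aq uq] /= iq.
  by rewrite inE mem_nth // orbT index_uniq // (set_nth_default a) // ltnW.
by rewrite (negbTE eq).
Qed.

Definition valid_pairs k : {set {perm E} * k.+1.-tuple E} :=
  [set z : {perm E} * k.+1.-tuple E | valid (rk z.1) z.2].

(** The rotated permutation, the head of the path and the two port bits form an injective code; the
    bits account for the factor 4. *)
Lemma card_valid_pairs k : #|valid_pairs k| <= 4 * #|E| * #|{perm E}|.
Proof.
pose code (z : {perm E} * k.+1.-tuple E) :=
  (port_code (thead z.2) z.2, thead z.2, (rot_perm z.2 * z.1)%g).
have <- : #|{: bool * bool * E * {perm E}}| = 4 * #|E| * #|{perm E}|.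
  by rewrite !card_prod card_bool.
have code_inj : {in valid_pairs k &, injective code}.
  move=> [s q] [s' q']; rewrite !inE /= => vq vq'; rewrite /code /=.
  set e0 := thead q => -[cq cq' hq sq].
  have tq (t : k.+1.-tuple E) e : thead t = head e t.
    by case/tupleP: t => a t; rewrite theadE.
  have eq : q = q'.
    apply/val_inj; apply: (@rotated_inj (rk s) (rk s') _ q q' e0 _ vq vq').
    - exact: (@rk_inj (rot_perm q * s)%g).
    - by apply/rotated_rot_perm/query_path_uniq; case/andP: vq => + _; apply.
    - by rewrite sq; apply/rotated_rot_perm/query_path_uniq; case/andP: vq' => + _; apply.
    - by rewrite !size_tuple.
    - by rewrite -!tq.
    by rewrite /port_code cq cq' -hq.
  (* With the path known, its rotation cancels from the product. *)
  by rewrite -eq in sq *; rewrite (mulgI _ _ _ sq).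
rewrite -(card_in_imset code_inj); exact: max_card.
Qed.

End Decoding.

(** * Alive edges and weighted path counts *)

Section Swapping.

Variable E : finType.
Local Notation N := #|E|.
Implicit Types (s : {perm E}) (i j : 'I_N).

Definition pos s j : E := (s^-1)%g (enum_val j).
Definition swap i j : {perm E} := tperm (enum_val i) (enum_val j).

Lemma rk_pos s j : rk s (pos s j) = j.
Proof. by rewrite /rk /pos permKV enum_valK. Qed.

Lemma pos_rk s e : pos s (enum_rank (s e)) = e.
Proof. by rewrite /pos enum_rankK permK. Qed.

Lemma rk_eq s e j : (rk s e == j) = (e == pos s j).
Proof.
apply/eqP/eqP => [/val_inj <-|->]; last exact: rk_pos.
by rewrite pos_rk.
Qed.

Lemma pos_swap s i j : pos (s * swap i j)%g i = pos s j.
Proof.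
apply: (@rk_inj _ (s * swap i j)%g); rewrite rk_pos /rk permM.
by rewrite /pos permKV /swap tpermR enum_valK.
Qed.

Lemma rk_swap_agree s i j :
  i <= j -> agree_below i (rk s) (rk (s * swap i j)%g).
Proof.
move=> ij e; rewrite /rk permM /swap; case: tpermP => // ->; rewrite !enum_valK.
  by rewrite ltnn ltnNge ij.
by rewrite ltnn orbF ltnNge ij.
Qed.

Lemma card_ord_ge i : #|[set j : 'I_N | i <= j]| = N - i.
Proof.
rewrite cardsE -sum1_card -[RHS]muln1 -(sum_nat_const_nat i N 1).
by rewrite big_geq_mkord.
Qed.

(* The element at position [i] is exchangeable with those at later positions. *)
Lemma sum_swap (F : {perm E} -> nat) i :
  (N - i) * (\sum_s F s) =
  \sum_(s : {perm E}) \sum_(j : 'I_N | i <= j) F (s * swap i j)%g.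
Proof.
rewrite exchange_big -card_ord_ge cardsE -sum_nat_const /=.
by apply: eq_bigr => j _; rewrite (reindex_inj (mulIg (swap i j))).
Qed.

End Swapping.

Section Alive.

Variables (E X : finType) (p1 p2 : E -> X).

Local Notation has_port := (has_port p1 p2).
Local Notation clash := (clash p1 p2).
Local Notation greedy := (greedy p1 p2).
Local Notation calls := (calls p1 p2).
Local Notation query_path := (query_path p1 p2).
Local Notation N := #|E|.

Implicit Types (r : E -> nat) (t : nat) (x : X) (e f g h : E) (s : {perm E}).

Definition free_port r t x :=
  [forall h, has_port x h && (r h < t) ==> ~~ greedy r h].

Definition alive r t f :=
  [&& t <= r f, free_port r t (p1 f) & free_port r t (p2 f)].

Definition alive_at r t x := [set f | has_port x f && alive r t f].

Lemma free_portP r t x h :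
  free_port r t x -> has_port x h -> r h < t -> ~~ greedy r h.
Proof. by move=> /forallP/(_ h)/implyP H xh ht; apply: H; rewrite xh. Qed.

Lemma alive_port r t x f : alive r t f -> has_port x f -> free_port r t x.
Proof. by case/and3P=> _ f1 f2 /orP[]/eqP->. Qed.

Lemma free_port_leq r t t' x : t <= t' -> free_port r t' x -> free_port r t x.
Proof.
move=> tt' fp; apply/forallP=> h; apply/implyP=> /andP[xh ht].
exact: free_portP fp xh (leq_trans ht tt').
Qed.

Lemma alive_leq r t t' f : t <= t' -> alive r t' f -> alive r t f.
Proof.
move=> tt' /and3P[tf f1 f2]; apply/and3P.
by split; [apply: leq_trans tf | apply: free_port_leq f1 | apply: free_port_leq f2].
Qed.

(** The loop of [e] reaches [g] only past rejections, so no accepted edge of rank below [r g]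
    occupies a port of [e]. *)
Lemma calls_alive r e g : calls r e g -> alive r (r g) e.
Proof.
move=> ceg; have lt := calls_lt ceg; rewrite /alive (ltnW lt) /=.
have H x : has_port x e -> free_port r (r g) x.
  move=> xe; apply/forallP=> h; apply/implyP=> /andP[xh hg].
  apply: (calls_rejected ceg) => //; apply: (clash_port _ xe xh) => eh.
  by move: hg; rewrite -eh ltnNge ltnW.
by rewrite !H // /has_port eqxx ?orbT.
Qed.

Lemma free_port_agree t r r' x :
  agree_below t r r' -> free_port r t x = free_port r' t x.
Proof.
move=> ag; apply: eq_forallb => h; rewrite -(agree_below_lt h ag (leqnn t)).
by case: (boolP (_ && _)) => //= /andP[_ ht]; rewrite (greedy_agree _ _ ag ht).
Qed.

Lemma alive_agree t r r' f : agree_below t r r' -> alive r t f = alive r' t f.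
Proof.
move=> ag; rewrite /alive !(free_port_agree _ ag); congr (_ && _).
by rewrite leqNgt [RHS]leqNgt (agree_below_lt f ag (leqnn t)).
Qed.

Lemma alive_greedy r f : alive r (r f) f -> greedy r f.
Proof.
move=> af; rewrite greedyE; apply/forallP=> h; apply/implyP=> /andP[].
case/clashP=> _ [x xf xh] hf.
exact: free_portP (alive_port af xf) xh hf.
Qed.

Lemma alive_at_reveal r x f :
  f \in alive_at r (r f) x -> alive_at r (r f).+1 x = set0.
Proof.
rewrite inE => /andP[xf /alive_greedy gf]; apply/setP=> g; rewrite !inE.
apply/negP=> /andP[xg /alive_port/(_ xg)/free_portP/(_ xf (leqnn _))].
by rewrite gf.
Qed.

Definition crowded d t x : {set {perm E}} :=
  [set s | d < #|alive_at (rk s) t x|].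

(** The edge revealed at time [i] is uniform among [N - i] candidates. If it is one of the more than
    [d] alive edges at [x], it is accepted and no edge at [x] stays alive. *)
Lemma card_crowded_step d x (i : 'I_N) :
  N * #|crowded d i.+1 x| <= (N - d.+1) * #|crowded d i x|.
Proof.
have ltiN := ltn_ord i.
have sub : #|crowded d i.+1 x| <= #|crowded d i x|.
  apply/subset_leq_card/subsetP => s; rewrite !inE => /leq_trans; apply.
  apply/subset_leq_card/subsetP => f; rewrite !inE => /andP[-> /=].
  exact: alive_leq.
(* Adding [i] copies of the monotonicity [sub] turns the denominator [N - i] into [N]. If [N - i] is
   at most [d], truncated subtraction makes the right side zero. *)
suff H : (N - i) * #|crowded d i.+1 x| <= (N - i - d.+1) * #|crowded d i x|.
  have [le|gt] := leqP d.+1 (N - i).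
    have := leq_add (leq_mul (leqnn i) sub) H; rewrite -!mulnDl.
    rewrite subnKC ?(ltnW ltiN) // => /leq_trans; apply.
    by rewrite leq_mul2r; apply/orP; right; lia.
  move: H; have -> : N - i - d.+1 = 0 by lia.
  by rewrite mul0n leqn0 muln_eq0 subn_eq0 leqNgt ltiN /= => /eqP->; rewrite muln0.
have cardE t : #|crowded d t x| = \sum_s (s \in crowded d t x : nat).
  by rewrite -sum1_card big_mkcond; apply: eq_bigr => s _; case: (s \in _).
rewrite {1}cardE sum_swap cardE big_distrr; apply: leq_sum => s _ /=.
set A := alive_at (rk s) i x.
have eqA (j : 'I_N) : i <= j -> alive_at (rk (s * swap i j)%g) i x = A.
  move=> ij; apply/setP=> f; rewrite !inE.
  by rewrite (alive_agree f (rk_swap_agree (s := s) ij)).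
case: (boolP (s \in crowded d i x)) => [|ns]; last first.
  rewrite muln0 leqn0 big1 // => j ij; apply/eqP; rewrite eqb0.
  apply: contra ns; rewrite !inE -/A -(eqA j ij) => /leq_trans; apply.
  apply/subset_leq_card/subsetP => f; rewrite !inE => /andP[-> /=].
  exact: alive_leq.
rewrite inE -/A muln1 => dA.
(* The ranks whose exchange with [i] reveals an edge alive at [x], which clears the port. *)
pose B := [set enum_rank (s e) | e in A].
have cB : #|B| = #|A| by apply: card_imset => e f /enum_rank_inj/perm_inj.
have sB : B \subset [set j : 'I_N | i <= j].
  apply/subsetP=> j /imsetP[e]; rewrite !inE => /andP[_ /and3P[ie _ _]] ->.
  exact: ie.
apply: (@leq_trans #|[set j : 'I_N | i <= j] :\: B|); last first.
  by rewrite cardsD (setIidPr sB) card_ord_ge cB leq_sub2l.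
rewrite -[leqRHS]sum1_card big_mkcond [leqRHS]big_mkcond; apply: leq_sum => j _.
rewrite !inE; case: ifP => // ij; rewrite andbT.
case: (boolP (j \in B)) => //= [/imsetP[e eA ej]|_]; last by case: (_ < _).
rewrite leqn0 eqb0 -leqNgt.
have ep : rk (s * swap i j)%g e = i.
  by apply/eqP; rewrite rk_eq pos_swap ej pos_rk.
have := @alive_at_reveal (rk (s * swap i j)%g) x e.
by rewrite ep eqA // => /(_ eA) ->; rewrite cards0.
Qed.

Lemma card_crowded d x t : t <= N ->
  #|crowded d t x| * N ^ t <= #|{perm E}| * (N - d.+1) ^ t.
Proof.
elim: t => [|t IHt] tN; first by rewrite !expn0 !muln1 max_card.
have /= step := card_crowded_step d x (Ordinal tN).
rewrite !expnS mulnCA [leqRHS]mulnCA mulnA.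
apply: leq_trans (leq_mul step (leqnn _)) _.
by rewrite -mulnA leq_mul2l IHt ?orbT // ltnW.
Qed.

(* Weighted number of query paths with top edge [f], all other edges having rank
   below [t]: a step doubles the weight, and only steps from edges with at most
   [dg] alive neighbours count, so that the expected growth stays bounded. *)
Fixpoint weight (dg : nat -> nat) r t f : nat :=
  if t is t'.+1 then
    weight dg r t' f +
    \sum_(e | [&& r e == t', #|[set g | clash e g && alive r t' g]| <= dg t',
                 clash e f & alive r t' f]) 2 * weight dg r t' e
  else 1.

Section Weight.

Variable dg : nat -> nat.
Local Notation weight := (weight dg).

Lemma weight_agree t r r' f : agree_below t r r' -> weight r t f = weight r' t f.
Proof.
elim: t f => // t IHt f ag /=.
have ag' : agree_below t r r'.
  by move=> e /orP[] et; apply: ag; rewrite !ltnS (ltnW et) ?orbT.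
rewrite IHt //; congr (_ + _); apply: eq_big => [e|e _]; last by rewrite IHt.
rewrite (alive_agree f ag'); congr [&& _, _ & _].
  apply/eqP/eqP => et; first by rewrite -ag // et ltnSn.
  by rewrite ag // et ltnSn orbT.
congr (_ <= _); apply: eq_card => g; rewrite !inE.
by rewrite (alive_agree g ag').
Qed.

Lemma weight_leq r t t' f : t <= t' -> weight r t f <= weight r t' f.
Proof.
move/subnK=> <-; elim: (t' - t) => // k IHk.
by rewrite addSn /=; apply: leq_trans IHk (leq_addr _ _).
Qed.

Lemma sum_weight_step r t : \sum_f weight r t.+1 f =
  \sum_f weight r t f +
  \sum_(e | (r e == t) && (#|[set g | clash e g && alive r t g]| <= dg t))
     2 * weight r t e * #|[set g | clash e g && alive r t g]|.
Proof.
rewrite /= big_split /=; congr (_ + _).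
rewrite (exchange_big_dep (fun e => (r e == t) &&
   (#|[set g | clash e g && alive r t g]| <= dg t))) /=; last first.
  by move=> f e _ /and4P[-> ->].
apply: eq_bigr => e /andP[-> ->] /=.
rewrite -sum1_card big_distrr /=; apply: eq_big => [f|f _]; rewrite ?inE //.
by rewrite muln1.
Qed.

(** The revealed edge is uniform among [N - i] candidates and passes twice its weight to at most
    [dg i] alive neighbours. *)
Lemma sum_weight_swap (i : 'I_N) :
  (N - i) * \sum_s \sum_f weight (rk s) i.+1 f <=
  (N - i + 2 * dg i) * \sum_s \sum_f weight (rk s) i f.
Proof.
rewrite sum_swap big_distrr /=; apply: leq_sum => s _.
set S := \sum_f _.
have step (j : 'I_N) : i <= j ->
    \sum_f weight (rk (s * swap i j)%g) i.+1 f <=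
    S + 2 * dg i * weight (rk s) i (pos s j).
  move=> ij; have ag := rk_swap_agree (s := s) ij; rewrite sum_weight_step leq_add //.
    by apply/eq_leq/eq_bigr => f _; rewrite -(weight_agree _ ag).
  rewrite (eq_bigl (fun e => (e == pos s j) &&
    (#|[set g | clash e g && alive (rk (s * swap i j)%g) i g]| <= dg i))).
    rewrite big_mkcondr big_pred1_eq; case: ifP => // le.
    by rewrite -(weight_agree _ ag) mulnAC leq_mul2r leq_mul2l le !orbT.
  by move=> e; rewrite rk_eq pos_swap.
apply: leq_trans; first by apply: leq_sum => j ij; apply: step ij.
rewrite big_split /= mulnDl leq_add //.
  by rewrite sum_nat_const -card_ord_ge cardsE.
rewrite -big_distrr /= leq_mul2l; apply/orP; right.
(* Indexed by position, the candidates are the edges at [i] or later, a part of all edges summed in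
   [S]. *)
rewrite /S [leqRHS](reindex_onto (pos s) (fun e => enum_rank (s e))) /=; last first.
  by move=> e _; rewrite pos_rk.
rewrite [leqRHS](eq_bigl predT) => [|j].
  by rewrite [leqRHS](bigID (fun j : 'I_N => i <= j)) /= leq_addr.
by rewrite /pos permKV enum_valK eqxx.
Qed.

(** Each caller is alive when its callee is revealed, so it inherits twice the weight of the
    callee. *)
Lemma weight_query_path r q e0 i :
  (forall t e, #|[set g | clash e g && alive r t g]| <= dg t) ->
  query_path r q -> i < size q ->
  2 ^ i <= weight r (r (nth e0 q i)) (nth e0 q i).
Proof.
move=> small qP; elim: i => [|i IHi] iq.
  by apply: leq_trans (weight_leq r _ (leq0n _)).
have c := query_path_calls e0 qP iq.
apply: leq_trans (weight_leq r _ (calls_lt c)); rewrite /= expnS.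
apply: leq_trans (leq_addl _ _).
rewrite (bigD1 (nth e0 q i)) /=; last first.
  by rewrite eqxx small clash_sym (calls_clash c) (calls_alive c).
by apply: leq_trans (leq_addr _ _); rewrite leq_mul2l /= IHi // ltnW.
Qed.

End Weight.

End Alive.

(** * Long query paths are rare *)

(** Bernoulli's inequality for [(1 + d/n)^m], cleared of denominators. *)
Lemma bernoulli n d m : (n + m * d) * n ^ m <= n * (n + d) ^ m.
Proof.
elim: m => [|m IHm]; first by rewrite mul0n addn0.
apply: leq_trans (_ : (n + d) * (n * (n + d) ^ m) <= _); last first.
  by rewrite expnS mulnCA leqnn.
apply: leq_trans (leq_mul (leqnn (n + d)) IHm).
by rewrite expnS !mulnA leq_mul2r; apply/orP; right; nia.
Qed.

Lemma leq_double_exp n d m : 0 < n -> n <= m * d -> 2 * n ^ m <= (n + d) ^ m.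
Proof.
move=> n0 nmd.
rewrite -(leq_pmul2l n0); apply: leq_trans (bernoulli n d m).
by rewrite mulnA leq_mul2r; apply/orP; right; lia.
Qed.

(** From [(1 + d/n)^m >= 2] and [(1 - d^2/n^2)^m <= 1]. *)
Lemma leq_half_exp n d m : 0 < n -> n <= m * d -> 2 * (n - d) ^ m <= n ^ m.
Proof.
move=> n0 nmd; have [dn|/ltnW nd] := leqP n d.
  have m0 : 0 < m by case: m nmd => //; rewrite mul0n leqNgt n0.
  by move: dn; rewrite -subn_eq0 => /eqP->; rewrite exp0n // muln0.
have nm0 : 0 < n ^ m by rewrite expn_gt0 n0.
rewrite -(leq_pmul2l nm0) mulnCA mulnA.
apply: leq_trans (leq_mul (leq_double_exp n0 nmd) (leqnn _)) _.
rewrite -!expnMn; case: (posnP m) => [-> //|m0].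
by rewrite leq_exp2r // mulnC -subn_sqr leq_subLR leq_addl.
Qed.

(** Among [t] factors there are [l] blocks of length [t %/ l], each of which halves; the 2 in the
    hypothesis absorbs the rounding. For [t < l] the base [n - d] is zero. *)
Lemma leq_exp_decay l n d t :
  0 < n -> 2 * l * n <= d * t -> 2 ^ l * (n - d) ^ t <= n ^ t.
Proof.
move=> n0 H; case: (posnP l) => [->|l0].
  by rewrite mul1n; case: (posnP t) => [-> //|t0]; rewrite leq_exp2r ?leq_subr.
have [tl|lt] := ltnP t l.
  have nd : n <= d by nia.
  have t0 : 0 < t by case: t H {tl} => //; nia.
  by move: nd; rewrite -subn_eq0 => /eqP->; rewrite exp0n // muln0.
have E := divn_eq t l; have r := ltn_pmod t l0; have m0 : 0 < t %/ l by rewrite divn_gt0.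
set m := t %/ l in E m0 *; have nmd : n <= m * d by nia.
rewrite E !expnD mulnA leq_mul //.
  by rewrite !expnM -expnMn leq_exp2r // leq_half_exp.
by case: (posnP (t %% l)) => [-> //|r0]; rewrite leq_exp2r // leq_subr.
Qed.

Lemma card_exists_leq (A B : finType) (P : A -> pred B) :
  #|[set b | [exists a, P a b]]| <= \sum_a #|[set b | P a b]|.
Proof.
rewrite -sum1_card; under [leqRHS]eq_bigr do rewrite -sum1_card big_mkcond.
rewrite exchange_big big_mkcond /=; apply: leq_sum => b _.
rewrite inE; case: existsP => // -[a Pab].
by rewrite (bigD1 a) //= inE Pab leq_addr.
Qed.

Section Depth.

Variables (E X : finType) (p1 p2 : E -> X) (l : nat).

Local Notation has_port := (has_port p1 p2).
Local Notation clash := (clash p1 p2).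
Local Notation alive := (alive p1 p2).
Local Notation query_path := (query_path p1 p2).
Local Notation N := #|E|.
Local Notation M := #|{perm E}|.

Implicit Types (t : nat) (x : X) (s : {perm E}).

(** Chosen so that [(1 - (D t + 1)/N)^t] is at most [2^-l]; at time 0 only the trivial bound is
    available. *)
Definition crowd_bound t := if t == 0 then N else (2 * l * N) %/ t.

Local Notation D := crowd_bound.
Local Notation total t :=
  (\sum_(s : {perm E}) \sum_f weight p1 p2 (fun u => 2 * D u) (rk s) t f).

Lemma card_crowded_bound t x : t < N ->
  2 ^ l * #|crowded p1 p2 (D t) t x| <= M.
Proof.
move=> tN; have N0 : 0 < N by apply: leq_trans tN.
case: (posnP t) => [->|t0].
  rewrite /D eqxx (_ : crowded _ _ _ _ _ = set0) ?cards0 ?muln0 //.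
  by apply/setP => s; rewrite !inE ltnNge max_card.
have D2 : 2 * l * N <= (D t).+1 * t.
  by rewrite /D eqn0Ngt t0 /= ltnW // ltn_ceil.
have Nt0 : 0 < N ^ t by rewrite expn_gt0 N0.
rewrite -(leq_pmul2r Nt0) -mulnA.
apply: leq_trans (leq_mul (leqnn _) (card_crowded p1 p2 (D t) x (ltnW tN))) _.
by rewrite mulnCA leq_mul2l (leq_exp_decay N0 D2) orbT.
Qed.

Lemma total_step t c : 0 < t < N ->
  total t * (N - t).+1 ^ (8 * l) <= c * t ^ (8 * l) ->
  total t.+1 * (N - t) ^ (8 * l) <= c * t.+1 ^ (8 * l).
Proof.
case/andP=> t0 tN.
have /= := sum_weight_swap p1 p2 (fun v => 2 * D v) (Ordinal tN).
have Dt : D t * t <= 2 * l * N by rewrite /D eqn0Ngt t0 /= leq_divM.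
have : N = t + (N - t) by rewrite subnKC // ltnW.
have : 0 < N - t by rewrite subn_gt0.
move: (N - t) (D t) (total t) (total t.+1) Dt => u d S S' Dt u0 Nu.
set a := 8 * l => step IH.
have bt := bernoulli t 1 a; have bu := bernoulli u 1 a.
rewrite !muln1 !addn1 in bt bu.
have pos : 0 < (u * t) * u.+1 ^ a by rewrite !muln_gt0 u0 t0 expn_gt0.
rewrite -(leq_pmul2l pos).
move: (t ^ a) (u ^ a) (t.+1 ^ a) (u.+1 ^ a) bt bu IH => ta ua ta' ua' bt bu IH.
have le1 : (u + 2 * (2 * d)) * t <= (t + a) * (u + a).
  by rewrite Nu in Dt; rewrite /a; nia.
have -> : u * t * ua' * (S' * ua) = u * S' * (t * ua * ua') by lia.
apply: leq_trans (leq_mul step (leqnn _)) _.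
have -> : (u + 2 * (2 * d)) * S * (t * ua * ua') =
  (u + 2 * (2 * d)) * t * (S * ua' * ua) by lia.
apply: leq_trans (leq_mul le1 (leq_mul IH (leqnn ua))) _.
have -> : (t + a) * (u + a) * (c * ta * ua) =
  c * ((t + a) * ta * ((u + a) * ua)) by lia.
have -> : u * t * ua' * (c * ta') = c * (t * ta' * (u * ua')) by lia.
by rewrite leq_mul2l leq_mul ?orbT.
Qed.

Lemma total_bound : 0 < N -> total N <= 5 * N * M * N ^ (16 * l).
Proof.
move=> N0; set a := 8 * l.
have H t : 0 < t <= N ->
    total t * (N - t).+1 ^ a <= 5 * N * M * N ^ a * t ^ a.
  elim: t => // -[_ _|t IHt /andP[_ tN]].
    have step : N * total 1 <= (N + 2 * (2 * D 0)) * total 0.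
      by have := sum_weight_swap p1 p2 (fun v => 2 * D v) (Ordinal N0); rewrite subn0.
    have T0 : total 0 = M * N by rewrite /= !sum_nat_const muln1.
    (* At time 0 the degree bound is [2 * N], so the first step multiplies the total by at most
       5. *)
    have {}step : N * total 1 <= N * (5 * N * M).
      apply: leq_trans step _; rewrite T0 /D eqxx; lia.
    rewrite leq_pmul2l // in step.
    by rewrite exp1n muln1 subn1 prednK // leq_mul2r step orbT.
  have lt : 0 < t.+1 < N by [].
  rewrite subnSK //; apply: total_step lt _. exact: IHt (ltnW tN).
have := H N; rewrite N0 leqnn subnn exp1n muln1 => /(_ isT) /leq_trans; apply.
by rewrite -mulnA -expnD /a -mulnDl.
Qed.

Definition long_path k : {set {perm E}} :=
  [set s | [exists q : k.+1.-tuple E, query_path (rk s) q]].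

(** Union bound over ports and times for crowding; for the other rankings, Markov's inequality
    applied to the total weight, as a long path contributes at least [2 ^ k]. *)
Lemma card_long_path k : 2 ^ l * (5 * N ^ (16 * l)) <= 2 ^ k ->
  2 ^ l * #|long_path k| <= (#|X|).+1 * N * M.
Proof.
move=> kP; case: (posnP N) => [N0|N0].
  rewrite (_ : long_path k = set0) ?cards0 ?muln0 //; apply/setP => s.
  rewrite inE in_set0; apply/existsP => -[q _].
  by have := fintype0 (thead q); apply.
pose B := [set s | [exists x, [exists t : 'I_N, s \in crowded p1 p2 (D t) t x]]].
have cB : 2 ^ l * #|B| <= #|X| * N * M.
  apply: leq_trans (leq_mul (leqnn _) (card_exists_leq _)) _.
  rewrite -mulnA -sum_nat_const big_distrr; apply: leq_sum => x _ /=.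
  apply: leq_trans (leq_mul (leqnn _) (card_exists_leq _)) _.
  rewrite big_distrr /= -[in leqRHS](card_ord N) -sum_nat_const.
  apply: leq_sum => t _; apply: leq_trans (card_crowded_bound x (ltn_ord t)).
  rewrite leq_mul2l; apply/orP; right.
  by apply/subset_leq_card/subsetP => s; rewrite !inE.
have cL : 2 ^ l * #|long_path k :\: B| <= N * M.
  have k0 : 0 < 5 * N ^ (16 * l) by rewrite muln_gt0 expn_gt0 N0.
  rewrite -(leq_pmul2r k0) mulnAC.
  apply: leq_trans (leq_mul kP (leqnn _)) _.
  have -> : N * M * (5 * N ^ (16 * l)) = 5 * N * M * N ^ (16 * l) by lia.
  apply: leq_trans (total_bound N0).
  rewrite mulnC -sum_nat_const [leqRHS](bigID (fun s => s \in long_path k :\: B)) /=.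
  apply: leq_trans (leq_addr _ _); apply: leq_sum => s.
  rewrite !inE => /andP[nB /existsP[q qP]].
  have small t e : #|[set g | clash e g && alive (rk s) t g]| <= 2 * D t.
    have [tN|Nt] := ltnP t N; last first.
      rewrite eq_card0 // => g; rewrite !inE; apply/negP => /andP[_ /and3P[tg _ _]].
      by have := leq_trans (ltn_rk s g) Nt; rewrite ltnNge tg.
    have crowd x : #|alive_at p1 p2 (rk s) t x| <= D t.
      rewrite leqNgt; apply: contra nB => st.
      by apply/existsP; exists x; apply/existsP; exists (Ordinal tN); rewrite inE.
    rewrite mul2n -addnn; apply: leq_trans (leq_add (crowd (p1 e)) (crowd (p2 e))).
    apply: leq_trans (leq_card_setU _ _); apply/subset_leq_card/subsetP => g.
    by rewrite !inE => /andP[/andP[_ /orP[]] -> ->]; rewrite ?orbT.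
  set e := nth (thead q) q k; have kq : k < size q by rewrite size_tuple.
  apply: leq_trans (weight_query_path (thead q) small qP kq) _.
  apply: leq_trans (weight_leq _ _ _ _ _ (ltnW (ltn_rk s e))) _.
  by rewrite (bigD1 e) //= leq_addr.
have sub : #|long_path k| <= #|B| + #|long_path k :\: B|.
  by rewrite -(cardsID B (long_path k)) leq_add2r subset_leq_card // subsetIr.
apply: leq_trans (leq_mul (leqnn _) sub) _.
by rewrite mulnDr mulSn mulnDl addnC leq_add.
Qed.

End Depth.

(** * The expected number of queries *)

Section Queries.

Variables (E X V : finType) (p1 p2 : E -> X) (I : V -> pred E).
Hypothesis I_le2 : forall e, #|[set v | I v e]| <= 2.

Local Notation calls := (calls p1 p2).
Local Notation called_by := (called_by p1 p2).
Local Notation query_path := (query_path p1 p2).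
Local Notation valid := (valid p1 p2).
Local Notation long_path := (long_path p1 p2).
Local Notation N := #|E|.
Local Notation M := #|{perm E}|.

Implicit Types (r : E -> nat) (v : V) (e f g : E) (s : {perm E}).

Definition reached r v e := [exists f, I v f && connect (called_by r) e f].

Lemma reached_start r v e : I v e -> reached r v e.
Proof. by move=> ve; apply/existsP; exists e; rewrite ve connect0. Qed.

Lemma reached_connect r v e g : reached r v e -> connect (called_by r) g e ->
  reached r v g.
Proof.
case/existsP=> f /andP[vf ef] ge; apply/existsP; exists f.
by rewrite vf (connect_trans ge ef).
Qed.

Definition queries r v := [set z : E * E | reached r v z.1 && calls r z.1 z.2].

Lemma card_queries r v :
  #|queries r v| = \sum_(e | reached r v e) #|[set g | calls r e g]|.
Proof.
rewrite -sum1_card (eq_bigl (fun z : E * E => reached r v z.1 && calls r z.1 z.2)).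
  rewrite -(pair_big_dep _ _ (fun _ _ => 1)) /=; apply: eq_bigr => e _.
  by rewrite -sum1_card; apply: eq_bigl => g; rewrite inE.
by move=> z; rewrite inE.
Qed.

Lemma query_path_short k s q :
  s \notin long_path k -> query_path (rk s) q -> size q <= k.
Proof.
move=> ns qP; rewrite leqNgt; apply: contra ns => kq.
have sz : size (take k.+1 q) == k.+1 by rewrite size_takel.
by rewrite inE; apply/existsP; exists (Tuple sz); apply: take_sorted.
Qed.

Definition last_call k (q : k.+2.-tuple E) := (nth (thead q) q 1, thead q).

Lemma queries_path k s v z : s \notin long_path k -> z \in queries (rk s) v ->
  exists (j : 'I_k) (q : j.+2.-tuple E),
    [/\ valid (rk s) q, I v (last (thead q) q) & last_call q = z].
Proof.
case: z => e g ns; rewrite inE => /andP[/existsP[f /andP[vf /connectP[q qP fq]]] /= ceg].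
have : query_path (rk s) (g :: e :: q) by rewrite /query_path /= qP andbT; apply: ceg.
case/query_path_reduce=> q' [qP' tf lq _].
have ltk : size q' < k.
  by apply: ltnW; apply: query_path_short ns qP'.
have sz : size (g :: e :: q') == (size q').+2 by [].
exists (Ordinal ltk), (Tuple sz); split=> //; last by rewrite /= lq -fq.
by apply/andP; split; [apply: qP' | apply: tf].
Qed.

(** Each query is the last call of some valid path that starts at [v], and the starting edge of a
    path is incident to at most two vertices. *)
Lemma sum_queries_good k s : s \notin long_path k ->
  \sum_v #|queries (rk s) v| <=
  \sum_(j < k) 2 * #|[set q : j.+2.-tuple E | valid (rk s) q]|.
Proof.
move=> ns.
apply: (@leq_trans (\sum_v \sum_(z : E * E) \sum_(j < k)
    \sum_(q : j.+2.-tuple E | valid (rk s) q && I v (last (thead q) q))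
       (last_call q == z))).
  apply: leq_sum => v _; rewrite -sum1_card big_mkcond; apply: leq_sum => z _.
  case: ifP => // /(queries_path ns)[j [q [vq Iq eqz]]].
  rewrite (bigD1 j) //= (bigD1 q) /=; last by rewrite vq.
  by rewrite eqz eqxx.
under eq_bigr do rewrite exchange_big.
rewrite exchange_big; apply: leq_sum => j _ /=.
apply: (@leq_trans (\sum_v \sum_(q : j.+2.-tuple E |
    valid (rk s) q && I v (last (thead q) q)) 1)).
  apply: leq_sum => v _; rewrite exchange_big; apply: leq_sum => q _ /=.
  by rewrite (bigD1 (last_call q)) //= eqxx big1 // => z; rewrite eq_sym => /negbTE ->.
rewrite (exchange_big_dep (fun q : j.+2.-tuple E => valid (rk s) q)) /=.
  rewrite -sum1_card big_distrr; apply: (@leq_trans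
    (\sum_(q : j.+2.-tuple E | valid (rk s) q) 2)).
    apply: leq_sum => q vq; apply: leq_trans (I_le2 (last (thead q) q)).
    by rewrite -sum1_card; apply/eq_leq/eq_bigl => v; rewrite inE vq.
  by apply/eq_leq/eq_big => q; rewrite ?inE // muln1.
by move=> v q _ /andP[].
Qed.

(** Rankings without long paths give [8 * k * N * M] by [card_valid_pairs]. The others get the
    trivial bound [N * N] per vertex, and [lP] makes them rare enough to add only [N * M]. *)
Lemma sum_queries l k : #|X|.+1 * #|V| * N * N <= 2 ^ l ->
  2 ^ l * (5 * N ^ (16 * l)) <= 2 ^ k ->
  \sum_s \sum_v #|queries (rk s) v| <= (8 * k + 1) * N * M.
Proof.
move=> lP kP; rewrite (bigID (fun s => s \in long_path k)) /= addnC.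
have -> : (8 * k + 1) * N * M = 8 * k * N * M + N * M by lia.
apply: leq_add.
  apply: leq_trans; first by apply: leq_sum => s; apply: sum_queries_good.
  apply: (@leq_trans
    (\sum_s \sum_(j < k) 2 * #|[set q : j.+2.-tuple E | valid (rk s) q]|)).
    by rewrite [leqRHS](bigID (fun s => s \notin long_path k)) /= leq_addr.
  rewrite exchange_big /=.
  apply: (@leq_trans (\sum_(j < k) 2 * (4 * N * M))).
    apply: leq_sum => j _; rewrite -big_distrr leq_mul2l /=.
    apply: leq_trans (card_valid_pairs p1 p2 j.+1); apply/eq_leq.
    rewrite -sum1_card (eq_bigl (fun z : {perm E} * j.+2.-tuple E => valid (rk z.1) z.2)).
      rewrite -(pair_big_dep predT
        (fun s (q : j.+2.-tuple E) => valid (rk s) q) (fun _ _ => 1)) /=.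
      by apply: eq_bigr => s _; rewrite -sum1_card; apply: eq_bigl => q; rewrite inE.
    by move=> z; rewrite inE.
  rewrite sum_nat_const card_ord mulnA mulnA mulnA; have -> : k * 2 * 4 = 8 * k by lia.
  by [].
apply: (@leq_trans (#|long_path k| * (#|V| * (N * N)))).
  rewrite -sum_nat_const; apply: leq_sum => s _.
  rewrite -sum_nat_const; apply: leq_sum => v _.
  by rewrite -card_prod max_card.
have l0 : 0 < 2 ^ l by rewrite expn_gt0.
rewrite -(leq_pmul2l l0) mulnA.
apply: leq_trans (leq_mul (card_long_path p1 p2 kP) (leqnn _)) _.
apply: leq_trans (leq_mul lP (leqnn (N * M))).
by apply: eq_leq; lia.
Qed.

End Queries.

(** * The memoized oracle *)

Section Oracle.

Variables (n : nat) (adj : rel 'I_n) (K : nat).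

Local Notation E := (Eprime adj K).

Definition eport1 (e : E) : 'I_n * bool := (ep1 e, port1 e).
Definition eport2 (e : E) : 'I_n * bool := (ep2 e, port2 e).

Local Notation clash := (clash eport1 eport2).
Local Notation calls := (calls eport1 eport2).
Local Notation greedy := (greedy eport1 eport2).
Local Notation called_by := (called_by eport1 eport2).

Implicit Types (e f g h : E) (u v : 'I_n).

Lemma ep1_neq_ep2 e : (ep1 e == ep2 e) = false.
Proof.
case/andP: (valP e) => lt _; apply/eqP; rewrite /ep1 /ep2 => eq12.
by rewrite eq12 ltnn in lt.
Qed.

Lemma conflictingE e f : conflicting e f = clash e f.
Proof.
have port_atE w b : is_endpoint f w && (b == port_at f w) =
    has_port eport1 eport2 (w, b) f.
  rewrite /is_endpoint /port_at /has_port /eport1 /eport2 !xpair_eqE.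
  case: (eqVneq w (ep1 f)) => [->|_] /=; last by [].
  by rewrite ep1_neq_ep2 orbF.
have i1 : is_endpoint e (ep1 e) by rewrite /is_endpoint eqxx.
have i2 : is_endpoint e (ep2 e) by rewrite /is_endpoint eqxx orbT.
have q1 : port_at e (ep1 e) = port1 e by rewrite /port_at eqxx.
have q2 : port_at e (ep2 e) = port2 e by rewrite /port_at eq_sym ep1_neq_ep2.
rewrite /conflicting /conflict_at /clash /eport1 /eport2 -!port_atE.
by rewrite i1 i2 q1 q2 -andb_orr.
Qed.

Lemma endpoint_other g u : is_endpoint g (other g u).
Proof. by rewrite /is_endpoint /other; case: ifP; rewrite eqxx ?orbT. Qed.

Lemma card_endpoints e : #|[set v | is_endpoint e v]| <= 2.
Proof.
apply: leq_trans (_ : #|[set ep1 e; ep2 e]| <= 2).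
  by apply/subset_leq_card/subsetP => v; rewrite !inE.
by rewrite cards2 ltnS leq_b1.
Qed.

Variable s : {perm E}.

Local Notation r := (rk s).
Local Notation memo := (seq ((E * 'I_n) * bool)).

Definition num_calls e := #|[set g | calls r e g]|.

Definition memo_ok (m : memo) :=
  uniq (map fst m) /\ (forall p, p \in m -> p.2 = greedy r p.1.1).

Definition memo_cost (m : memo) := \sum_(p <- m) num_calls p.1.1.

Lemma memo_lookup_some (m : memo) k b : memo_ok m ->
  memo_lookup m k = Some b -> b = greedy r k.1.
Proof.
case=> _ H; rewrite /memo_lookup.
case E1 : (map snd _) => [//|c l] [<-].
have : c \in [seq p.2 | p <- m & p.1 == k] by rewrite E1 inE eqxx.
by case/mapP=> p; rewrite mem_filter => /andP[/eqP<- /H <-].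
Qed.

Lemma memo_lookup_none (m : memo) k : memo_lookup m k = None -> k \notin map fst m.
Proof.
rewrite /memo_lookup; case E1 : (map snd _) => [|//] _.
apply/mapP => -[p pm kp]; have : p.2 \in [seq p.2 | p <- m & p.1 == k].
  by apply: map_f; rewrite mem_filter pm kp eqxx.
by rewrite E1.
Qed.

Lemma mem_lower_conflicts e g :
  (g \in lower_conflicts s e) = clash e g && (r g < r e).
Proof. by rewrite mem_sort mem_filter mem_enum andbT conflictingE. Qed.

Lemma uniq_lower_conflicts e : uniq (lower_conflicts s e).
Proof. by rewrite sort_uniq filter_uniq // enum_uniq. Qed.

Lemma sorted_lower_conflicts e :
  sorted (fun a b => r a <= r b) (lower_conflicts s e).
Proof. by apply: sort_sorted => a b; apply: leq_total. Qed.

(** The anonymous inner loop of [EO], named so that [EO_S] holds by conversion. *)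
Definition eo_loop fuel e :=
  fix loop (l : seq E) (st : state adj K) : bool * state adj K :=
    match l with
    | [::] => (true, st)
    | g :: l' =>
      let r := EO s fuel g (other g (conflict_vertex e g)) st in
      if r.1 then (false, r.2) else loop l' r.2
    end.

Lemma EO_S fuel e u st :
  EO s fuel.+1 e u st =
  match memo_lookup st.1 (e, u) with
  | Some b => (b, (st.1, st.2.+1))
  | None =>
    let res := eo_loop fuel e (lower_conflicts s e) (st.1, st.2.+1) in
    (res.1, (((e, u), res.1) :: res.2.1, res.2.2))
  end.
Proof. by []. Qed.

(* Each recursive call is charged to the memo entry of its caller. *)
Definition extends (new : E -> Prop) k (st st' : state adj K) :=
  [/\ memo_ok st'.1,
      forall p, p \in st'.1 ->
        p \in st.1 \/ is_endpoint p.1.1 p.1.2 /\ new p.1.1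
    & st'.2 + memo_cost st.1 <= st.2 + k + memo_cost st'.1].

Lemma extends_weaken (new new' : E -> Prop) k st st' :
  (forall e, new e -> new' e) -> extends new k st st' -> extends new' k st st'.
Proof.
move=> sub [ok H c]; split=> // p /H [|[pe /sub]]; first by left.
by right.
Qed.

Lemma extends_trans new k k' st st' st'' :
  extends new k st st' -> extends new k' st' st'' -> extends new (k + k') st st''.
Proof.
move=> [ok H c] [ok' H' c']; split=> //; last by lia.
by move=> p /H' [/H|]; auto.
Qed.

Lemma greedy_lower e :
  greedy r e = all (fun g => ~~ greedy r g) (lower_conflicts s e).
Proof.
rewrite greedyE; apply/forallP/allP => H g.
  by rewrite mem_lower_conflicts => eg; have /implyP := H g; apply.
by apply/implyP => eg; apply: H; rewrite mem_lower_conflicts.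
Qed.

Definition below e g := connect (called_by r) g e.
Definition strictly_below e g := r g < r e /\ connect (called_by r) g e.

Definition EO_spec fuel := forall e u st,
  r e < fuel -> memo_ok st.1 -> is_endpoint e u ->
  (EO s fuel e u st).1 = greedy r e /\
  extends (fun g => r g <= r e /\ below e g) 1 st (EO s fuel e u st).2.

(** The last hypothesis is the loop invariant: every conflict already passed was rejected. As [l] is
    sorted, its head therefore satisfies [calls]. *)
Lemma eo_loop_spec fuel e l st : EO_spec fuel ->
  r e <= fuel -> memo_ok st.1 -> sorted (fun a b => r a <= r b) l -> uniq l ->
  {subset l <= lower_conflicts s e} ->
  (forall h, h \in lower_conflicts s e -> h \in l \/ ~~ greedy r h) ->
  let res := eo_loop fuel e l st in
  res.1 = all (fun g => ~~ greedy r g) l /\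
  extends (strictly_below e) (count (calls r e) l) st res.2.
Proof.
move=> IH re; elim: l st => [|g l IHl] st ok sl ul sub rest.
  by split=> //; split=> // [p|]; [left | rewrite addn0].
have glow : g \in lower_conflicts s e by apply: sub; rewrite inE eqxx.
have := glow; rewrite mem_lower_conflicts => /andP[eg ge].
have ceg : calls r e g.
  apply/and3P; split=> //; apply/forallP => h; apply/implyP => /andP[eh hg].
  have hlow : h \in lower_conflicts s e.
    by rewrite mem_lower_conflicts eh (ltn_trans hg).
  case: (rest h hlow) => //; rewrite inE => /orP[/eqP hh|hl].
    by rewrite hh ltnn in hg.
  have tr : transitive (fun a b => r a <= r b) by move=> b a c; apply: leq_trans.
  have /allP/(_ h hl) := order_path_min tr sl.
  by rewrite leqNgt hg.
have [] := IH g (other g (conflict_vertex e g)) st (leq_trans ge re) ok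
  (endpoint_other _ _).
rewrite /= ceg; case: (EO _ _ _ _ _) => b st1 /= -> ext.
have ext1 : extends (strictly_below e) 1 st st1.
  apply: extends_weaken ext => h [hg bh]; split; first exact: leq_ltn_trans ge.
  by apply: (connect_trans bh); apply: (@connect1 _ (called_by r) g e).
case gg: (greedy r g) => /=.
  split=> //; case: ext1 => ok1 H1 c1; split=> //.
  by apply: leq_trans c1 _; rewrite leq_add2r leq_add2l leq_addr.
case/andP: ul => gl ul.
have [|||||-> ext2] := IHl st1; rewrite //.
- by case: ext1.
- exact: path_sorted sl.
- by move=> h hl; apply: sub; rewrite inE hl orbT.
- by move=> h /rest; rewrite inE => -[/orP[/eqP->|]|]; [right; rewrite gg|left|right].
by split=> //; apply: extends_trans ext1 ext2.
Qed.

Lemma EO_correct fuel : EO_spec fuel.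
Proof.
elim: fuel => // fuel IH e u st ef ok eu; rewrite EO_S.
case lk: memo_lookup => [b|].
  split; first exact: memo_lookup_some ok lk.
  by split=> //= [p|]; [left | lia].
have notin := memo_lookup_none lk.
have [||||||] := @eo_loop_spec fuel e (lower_conflicts s e) (st.1, st.2.+1) IH;
  rewrite //.
- exact: sorted_lower_conflicts.
- exact: uniq_lower_conflicts.
- by move=> h; left.
rewrite -greedy_lower; case: (eo_loop _ _ _ _) => b st1 /= -> [[u1 ok1] H1 c1].
split=> //; split=> /=.
- split=> /= [|p]; last by rewrite inE => /orP[/eqP->|/ok1].
  (* The loop stores new entries only for edges ranked strictly below [e], so the key [(e, u)] is
     still fresh. *)
  rewrite u1 andbT; apply/mapP => -[p pm ep]; case: (H1 p pm) => [pm'|[_ [lt _]]].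
    by case/negP: notin; rewrite ep map_f.
  by rewrite -ep ltnn in lt.
- move=> p; rewrite inE => /orP[/eqP->|/H1[|[pe [lt b1]]]] /=; last 2 first.
  + by left.
  + by right; split=> //; split=> //; apply: ltnW.
  by right; split=> //; split=> //; apply: connect0.
rewrite /memo_cost big_cons /= -!/(memo_cost _).
have : count (calls r e) (lower_conflicts s e) <= num_calls e.
  rewrite -size_filter /num_calls cardE; apply: uniq_leq_size.
    by rewrite filter_uniq // uniq_lower_conflicts.
  by move=> g; rewrite mem_filter mem_enum inE => /andP[].
by move: c1 => /=; lia.
Qed.

Definition vo_step v (acc : nat * state adj K) e :=
  let res := EO s #|E|.+1 e (other e v) acc.2 in
  ((if res.1 then acc.1.+1 else acc.1), res.2).

Local Notation reached := (reached eport1 eport2 (fun v e => is_endpoint e v) r).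

Lemma foldl_vo_step v l acc :
  {subset l <= incident s v} -> memo_ok acc.2.1 ->
  extends (reached v) (size l) acc.2 (foldl (vo_step v) acc l).2.
Proof.
elim: l acc => [|e l IHl] acc sub ok; first by split=> // [p|]; [left|rewrite addn0].
have ev : is_endpoint e v.
  by have := sub e; rewrite inE eqxx mem_sort mem_filter => /(_ isT)/andP[].
have [_ ext] := @EO_correct #|E|.+1 e (other e v) acc.2 (ltnW (ltn_rk s e)) ok
  (endpoint_other _ _).
have ext1 : extends (reached v) 1 acc.2 (vo_step v acc e).2.
  apply: extends_weaken ext => g [_ ge].
  by apply: reached_connect ge; apply: reached_start.
apply: (extends_trans (k := 1) ext1); apply: IHl; last by case: ext1.
by move=> g gl; apply: sub; rewrite inE gl orbT.
Qed.

(** Memo keys are distinct pairs of a reached edge and one of its endpoints, so each reached edge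
    pays for its calls at most twice. The first term counts the direct calls of the vertex
    oracle. *)
Lemma T_leq v : T s v <= #|[set e : E | is_endpoint e v]| +
  2 * #|queries eport1 eport2 (fun v e => is_endpoint e v) r v|.
Proof.
have ok0 : memo_ok [::] by [].
have [[um _] Hm] := @foldl_vo_step v (incident s v) (0, ([::], 0)) (fun _ => id) ok0.
rewrite -/(VO_run s v) {1}/memo_cost big_nil addn0 add0n -/(T s v).
move=> /leq_trans; apply; apply: leq_add.
  rewrite size_sort size_filter -size_filter cardE; apply: uniq_leq_size.
    by rewrite filter_uniq // enum_uniq.
  by move=> e; rewrite mem_filter mem_enum inE => /andP[].
set m := (VO_run s v).2.1 in um Hm *.
have -> : memo_cost m = \sum_(k <- map fst m) num_calls k.1 by rewrite big_map.
rewrite big_uniq //=.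
set R := reached v in Hm *.
apply: (@leq_trans (\sum_(e | R e) \sum_(u | is_endpoint e u) num_calls e)).
  rewrite pair_big_dep /= big_mkcond [leqRHS]big_mkcond; apply: leq_sum => k _.
  case: ifP => // /mapP[p pm ->]; case: (Hm p pm) => // -[pe pR].
  by rewrite pR pe.
rewrite card_queries big_distrr; apply: leq_sum => e _ /=.
rewrite sum_nat_const leq_mul2r; apply/orP; right.
by apply: leq_trans (card_endpoints e); rewrite cardsE.
Qed.

End Oracle.

(** * Choice of parameters and passage to real logarithms *)

Lemma card_Eprime n (adj : rel 'I_n) K : #|Eprime adj K| = num_edges adj * K.+2.
Proof.
rewrite card_sig /num_edges -[K.+2 in RHS]card_ord -cardsT -cardsX.
by apply: eq_card => x; rewrite !inE andbT.
Qed.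

Lemma num_edges_leq n (adj : rel 'I_n) : num_edges adj <= n * n.
Proof. by apply: leq_trans (max_card _) _; rewrite card_prod card_ord. Qed.

Lemma sum_T n (adj : rel 'I_n) K l k (N := #|Eprime adj K|) :
  (n * 2).+1 * n * N * N <= 2 ^ l -> 2 ^ l * (5 * N ^ (16 * l)) <= 2 ^ k ->
  \sum_(v : 'I_n) \sum_(s : {perm Eprime adj K}) T s v <=
  (16 * k + 4) * N * #|{perm Eprime adj K}|.
Proof.
move=> lP kP; rewrite exchange_big /=.
have Q := @sum_queries _ ('I_n * bool)%type _ (@eport1 n adj K) (@eport2 n adj K)
  (fun v e => is_endpoint e v) (@card_endpoints n adj K) l k.
rewrite card_prod card_bool !card_ord in Q; have {Q} := Q lP kP.
set M := #|{perm Eprime adj K}|; rewrite -/N => Q.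
apply: (@leq_trans (\sum_(s : {perm Eprime adj K}) (2 * N +
    2 * \sum_v #|queries (@eport1 n adj K) (@eport2 n adj K)
                   (fun v e => is_endpoint e v) (rk s) v|))).
  apply: leq_sum => s _.
  apply: leq_trans; first by apply: leq_sum => v _; apply: T_leq.
  rewrite big_split /= -big_distrr leq_add2r.
  under eq_bigr do rewrite -sum1_card big_mkcond.
  rewrite exchange_big /= [leqRHS]mulnC -sum_nat_const; apply: leq_sum => e _.
  apply: leq_trans (card_endpoints e); rewrite -sum1_card [leqRHS]big_mkcond.
  by apply: leq_sum => v _; rewrite !inE.
rewrite big_split sum_nat_const -[X in _ + X <= _]big_distrr /= -/M.
apply: leq_trans (leq_add (leqnn _) (leq_mul (leqnn 2) Q)) _.
move: N M {lP kP Q} => a b; nia.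
Qed.

Lemma sum_T_log n (adj : rel 'I_n) K (b := up_log 2 n) :
  1 < n -> \sum_(v : 'I_n) \sum_(s : {perm Eprime adj K}) T s v <=
  (1024 * (K + 6) ^ 2 * K.+2) * b ^ 2 * num_edges adj *
  #|{perm Eprime adj K}|.
Proof.
move=> n1; have nb : n <= 2 ^ b := up_logP n (isT : 1 < 2).
have b0 : 0 < b by case: (b) nb => //; lia.
(* [2 ^ (c * b)] bounds the number of edges; [l] and [k] are then the exponents required by [sum_T],
   with 3 covering the factor 5. Thus [k] is quadratic in [b]. *)
pose c := K + 4; pose l := (2 * c + 4) * b; pose k := l + 3 + c * b * (16 * l).
have Nb : #|Eprime adj K| <= 2 ^ (c * b).
  have K2 := ltnW (ltn_expl K.+2 (isT : 1 < 2)).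
  rewrite card_Eprime; apply: leq_trans (leq_mul (num_edges_leq adj) K2) _.
  apply: leq_trans (leq_mul (leq_mul nb nb) (leqnn _)) _.
  by rewrite -!expnD leq_exp2l // /c; nia.
have := @sum_T n adj K l k; rewrite card_Eprime in Nb *.
move: (num_edges adj) Nb => m Nb H.
apply: leq_trans (H _ _) _.
- have n2 : (n * 2).+1 <= 2 ^ (b + 2) by rewrite expnD; nia.
  apply: leq_trans (leq_mul (leq_mul (leq_mul n2 nb) Nb) Nb) _.
  by rewrite -!expnD leq_exp2l // /l; nia.
- apply: (@leq_trans (2 ^ l * (2 ^ 3 * (2 ^ (c * b)) ^ (16 * l)))).
    rewrite leq_mul // leq_mul //.
    have l0 : 0 < 16 * l by rewrite /l; nia.
    by rewrite leq_exp2r.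
  by rewrite -expnM -!expnD addnA leqnn.
rewrite leq_mul2r; apply/orP; right.
suff kb : 16 * k + 4 <= 1024 * (K + 6) ^ 2 * b ^ 2.
  have := leq_mul kb (leqnn (m * K.+2)); nia.
rewrite /k /l /c; nia.
Qed.

Lemma INR_muln a b : INR (a * b) = Rmult (INR a) (INR b).
Proof. exact: mult_INR. Qed.

Lemma INR_expn a b : INR (a ^ b) = pow (INR a) b.
Proof. by elim: b => //= b IHb; rewrite expnS INR_muln IHb. Qed.

Lemma INR_leq a b : a <= b -> Rle (INR a) (INR b).
Proof. by move/leP; apply: le_INR. Qed.

Lemma ln_leq x y : Rlt 0 x -> Rle x y -> Rle (ln x) (ln y).
Proof.
move=> x0 [xy|->]; last exact: Rle_refl.
by left; apply: ln_increasing.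
Qed.

(** Rounding up costs at most one [ln 2], which [ln n] dominates since [n] is at least 2. *)
Lemma up_log_le_ln n : 1 < n ->
  Rle (Rmult (INR (up_log 2 n)) (ln 2)) (Rmult 2 (ln (INR n))).
Proof.
move=> n1; set b := up_log 2 n.
have b0 : 0 < b by have := up_logP n (isT : 1 < 2); rewrite -/b; case: (b) => //; lia.
have ln2 : Rle (ln 2) (ln (INR n)).
  by apply: ln_leq; [lra | have := INR_leq n1; rewrite /=; lra].
have H : Rle (Rmult (INR b.-1) (ln 2)) (ln (INR n)).
  rewrite -ln_pow; last by lra.
  rewrite -[IZR 2]/(INR 2) -INR_expn; apply: ln_leq.
    by apply: lt_0_INR; apply/ltP; rewrite expn_gt0.
  by apply: INR_leq; apply: ltnW; apply: up_log_gtn.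
have -> : INR b = Rplus (INR b.-1) 1 by rewrite -S_INR prednK.
lra.
Qed.

Section AverageBound.
Local Open Scope R_scope.

Lemma average_bound (S M n m b a t x : R) :
  0 < n -> 0 < M -> 0 <= m -> 0 <= b -> 0 < a -> 0 < t -> b * t <= 2 * x ->
  S <= a * b ^ 2 * m * M ->
  S / (n * M) <= 2 * a / (t * t) * (2 * m / n) * x ^ 2.
Proof.
move=> n0 M0 m0 b0 a0 t0 bt SM.
apply: (Rmult_le_reg_r (n * M)); first exact: Rmult_lt_0_compat.
have -> : S / (n * M) * (n * M) = S by field; lra.
have -> : 2 * a / (t * t) * (2 * m / n) * x ^ 2 * (n * M) =
  a * (((2 * x) / t) ^ 2) * m * M by field; lra.
apply: Rle_trans SM _.
apply: Rmult_le_compat_r; first lra.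
apply: Rmult_le_compat_r => //.
apply: Rmult_le_compat_l; first lra.
apply: pow_incr; split=> //.
apply: (Rmult_le_reg_r t) => //.
by have -> : 2 * x / t * t = 2 * x by field; lra.
Qed.

End AverageBound.

Theorem theorem5p4 :
  forall K : nat, (0 < K)%N ->
  exists (C : R) (N : nat), Rlt 0 C /\
    forall (n : nat) (adj : rel 'I_n),
      (N <= n)%N ->
      symmetric adj -> irreflexive adj ->
      Rle (expected_T adj K) (Rmult (Rmult C (avg_degree adj)) (pow (ln (INR n)) 2)).
Proof.
move=> K _; pose A := 1024 * (K + 6) ^ 2 * K.+2.
have ln2 : Rlt 0 (ln 2) by rewrite -ln_1; apply: ln_increasing; lra.
have A0 : Rlt 0 (INR A) by apply: lt_0_INR; apply/ltP; rewrite /A; nia.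
(* Passing from [b] to [ln n] costs [(2 / ln 2)^2]; one factor 2 of its 4 is already in the average
   degree. *)
exists (Rdiv (Rmult 2 (INR A)) (Rmult (ln 2) (ln 2))), 2; split.
  apply: Rdiv_lt_0_compat; first lra.
  exact: Rmult_lt_0_compat.
move=> n adj n1 _ _; rewrite /expected_T /avg_degree.
have := INR_leq (@sum_T_log n adj K n1); rewrite -/A.
set S := \sum_v _; rewrite 3!INR_muln INR_expn.
have := up_log_le_ln n1.
have M0 : Rlt 0 (INR #|{perm Eprime adj K}|).
  by apply: lt_0_INR; apply/ltP/card_gt0P; exists 1%g.
have n0 : Rlt 0 (INR n) by apply: lt_0_INR; apply/ltP; apply: ltnW.
have m0 := pos_INR (num_edges adj); have b0 := pos_INR (up_log 2 n).
exact: average_bound.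
Qed.
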